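(* Let $\mathcal{P}\colon \mathbb{C}\hookrightarrow\mathbb{E}$ be a projective cover of an exact category $\mathbb{E}$. Suppose that one of the following (equivalent) conditions holds: \begin{enumerate} \item[(a)] projective objects in $\mathbb{E}$ are internally projective; \item[(b)] the full subcategory $\mathrm{P}(\mathbb{E})$ of $\mathbb{E}$ on the projective objects (which is equivalent to the splitting of idempotents $\overline{\mathbb{C}}$ of $\mathbb{C}$) has binary products; \item[(c)] for every weak product $Z\xleftarrow{p_1}V\xrightarrow{p_2}X$ in $\mathbb{C}$ there is an idempotent $i\colon V\to V$ which is determined by projections and such that $p_1i=p_1$ and $p_2i=p_2$. \end{enumerate} Then the following are equivalent: \begin{enumerate} \item $\mathbb{C}$ has weak simple products; \item $\mathbb{C}$ has extensional simple products; \item $\mathbb{E}$ is cartesian closed. \end{enumerate}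
   Context: A category is exact if it has finite limits, regular epis are stable under pullback, and every equivalence relation $(r_1,r_2)\colon R\hookrightarrow X\times X$ has a coequaliser $q$ of $r_1,r_2$ such that $r_1,r_2$ is a kernel pair of $q$. An object $P$ of a category is (regular) projective if every arrow $P\to B$ lifts along every regular epi $A\to B$. A projective cover of an exact category $\mathbb{E}$ is (the inclusion $\mathcal{P}$ of) a full subcategory $\mathcal{P}\colon\mathbb{C}\hookrightarrow\mathbb{E}$ such that $\mathcal{P}X$ is projective in $\mathbb{E}$ for every $X$ in $\mathbb{C}$, and for every $A$ in $\mathbb{E}$ there are $X$ in $\mathbb{C}$ and a regular epi $\mathcal{P}X\to A$. In this situation $\mathbb{C}$ has weak finite limits. A weak limit is defined as a limit but without requiring uniqueness of the induced arrow. An object $P$ of a category with binary products is internally (regular) projective if for every object $C$, regular epi $r\colon A\to B$ and arrow $f\colon C\times P\to B$ there are an object $T$, a regular epi $t\colon T\to C$ and an arrow $f'\colon T\times P\to A$ with $rf'=f(t\times\mathrm{id}_P)$. A pseudo equivalence relation $x_1,x_2\colon\bar X\rightrightarrows X$ in $\mathbb{C}$ consists of arrows $x_1,x_2\colon\bar X\to X$ for which there are $\rho\colon X\to\bar X$, $\sigma\colon\bar X\to\bar X$ and $\tau\colon W\to\bar X$, where $W$ with $p_1,p_2\colon W\to\bar X$ is a weak pullback of $x_2$ and $x_1$ (so $x_2p_1=x_1p_2$), with $x_1\rho=x_2\rho=\mathrm{id}_X$, $x_1\sigma=x_2$, $x_2\sigma=x_1$, $x_1\tau=x_1p_1$, $x_2\tau=x_2p_2$.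 A weak kernel pair of a span $Z\xleftarrow{p_1}V\xrightarrow{p_2}X$ is a pair $v_1,v_2\colon\bar V\to V$ with $p_iv_1=p_iv_2$ for $i=1,2$, weakly universal with this property. Let $Z\xleftarrow{p_1}V\xrightarrow{p_2}X$ be a weak product. An arrow $f\colon V\to Y$ preserves projections with respect to a pseudo equivalence relation $y_1,y_2\colon\bar Y\rightrightarrows Y$ if, for a weak kernel pair $v_1,v_2\colon\bar V\to V$ of $p_1,p_2$, there is $\bar f\colon\bar V\to\bar Y$ with $y_i\bar f=fv_i$ for $i=1,2$. It is determined by projections if, for all parallel arrows $h,k$ into $V$, $p_1h=p_1k$ and $p_2h=p_2k$ imply $fh=fk$ (equivalently, it preserves projections with respect to $\mathrm{id}_Y,\mathrm{id}_Y$). Extensional simple product: let $y_1,y_2\colon\bar Y\rightrightarrows Y$ be a pseudo equivalence relation and $Z\xleftarrow{g_1}Y\xrightarrow{g_2}X$ a span with $g_1y_1=g_1y_2$ and $g_2y_1=g_2y_2$. Consider data $D=(W,w,V,q_1,q_2,e)$ where $w\colon W\to Z$, $W\xleftarrow{q_1}V\xrightarrow{q_2}X$ is a weak product, and $e\colon V\to Y$ preserves projections with respect to $y_1,y_2$ and satisfies $g_1e=wq_1$, $g_2e=q_2$. An extensional simple product of $g_1,g_2$ with respect to $y_1,y_2$ is such a $D$ with the property that for every other such $D'=(W',w',V',q_1',q_2',e')$ there are $h\colon W'\to W$ and $k\colon V'\to V$ with $wh=w'$, $q_1k=hq_1'$, $q_2k=q_2'$, $ek=e'$. $\mathbb{C}$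 has extensional simple products if one exists for all such $y_1,y_2$ and $g_1,g_2$. A weak simple product of a span $g_1,g_2$ is an extensional simple product of it with respect to $\mathrm{id}_Y,\mathrm{id}_Y$ (i.e. the same definition with ``determined by projections'' in place of ``preserves projections with respect to $y_1,y_2$''); $\mathbb{C}$ has weak simple products if every span in $\mathbb{C}$ has one. *)

(* Defs.v *)
From Stdlib Require Import List FinFun.

Set Implicit Arguments.
Unset Strict Implicit.
Unset Printing Implicit Defensive.

Declare Scope cat_scope.
Delimit Scope cat_scope with cat.

Record Category := {
  Obj :> Type;
  Hom : Obj -> Obj -> Type;
  idm : forall X, Hom X X;
  comp : forall X Y Z, Hom Y Z -> Hom X Y -> Hom X Z;
  comp_idl : forall X Y (f : Hom X Y), comp (idm Y) f = f;
  comp_idr : forall X Y (f : Hom X Y), comp f (idm X) = f;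
  comp_assoc : forall X Y Z W (h : Hom Z W) (g : Hom Y Z) (f : Hom X Y),
    comp h (comp g f) = comp (comp h g) f
}.

Arguments Hom {c} X Y.
Arguments idm {c} X.
Arguments comp {c X Y Z} g f.

Notation "X ~> Y" := (Hom X Y) (at level 90, no associativity) : cat_scope.
Notation "g ∘ f" := (comp g f) (at level 40, left associativity) : cat_scope.

Local Open Scope cat_scope.

Definition FullSub (E : Category) (P : E -> Prop) : Category := {|
  Obj := {X : E | P X};
  Hom := fun X Y => proj1_sig X ~> proj1_sig Y;
  idm := fun X => idm (proj1_sig X);
  comp := fun X Y Z g f => g ∘ f;
  comp_idl := fun X Y f => comp_idl f;
  comp_idr := fun X Y f => comp_idr f;
  comp_assoc := fun X Y Z W h g f => comp_assoc h g f
|}.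

Record Functor (J E : Category) := {
  fobj :> J -> E;
  fmap : forall i j, (i ~> j) -> (fobj i ~> fobj j);
  fmap_id : forall i, fmap (idm i) = idm (fobj i);
  fmap_comp : forall i j k (v : j ~> k) (u : i ~> j),
    fmap (v ∘ u) = fmap v ∘ fmap u
}.

Section Limits.

Variable E : Category.

Definition is_cone (J : Category) (D : Functor J E) (L : E)
    (p : forall j, L ~> D j) : Prop :=
  forall i j (u : i ~> j), fmap D u ∘ p i = p j.

Definition is_limit (J : Category) (D : Functor J E) (L : E)
    (p : forall j, L ~> D j) : Prop :=
  is_cone p /\
  forall (T : E) (t : forall j, T ~> D j), is_cone t ->
    exists! h : T ~> L, forall j, p j ∘ h = t j.

Definition finite_category (J : Category) : Prop :=
  Finite J /\ forall i j : J, Finite (i ~> j).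

Definition has_finite_limits : Prop :=
  forall J : Category, finite_category J ->
  forall D : Functor J E,
    exists (L : E) (p : forall j, L ~> D j), is_limit p.

Definition is_terminal (U : E) : Prop :=
  forall T : E, exists! h : T ~> U, True.

Definition is_product (A B P : E) (p1 : P ~> A) (p2 : P ~> B) : Prop :=
  forall (T : E) (f : T ~> A) (g : T ~> B),
    exists! h : T ~> P, p1 ∘ h = f /\ p2 ∘ h = g.

Definition has_binary_products : Prop :=
  forall A B : E, exists (P : E) (p1 : P ~> A) (p2 : P ~> B),
    is_product p1 p2.

Definition is_pullback (A B D P : E) (f : A ~> D) (g : B ~> D)
    (p1 : P ~> A) (p2 : P ~> B) : Prop :=
  f ∘ p1 = g ∘ p2 /\
  forall (T : E) (a : T ~> A) (b : T ~> B), f ∘ a = g ∘ b ->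
    exists! h : T ~> P, p1 ∘ h = a /\ p2 ∘ h = b.

Definition is_coequalizer (A B Q : E) (f g : A ~> B) (q : B ~> Q) : Prop :=
  q ∘ f = q ∘ g /\
  forall (T : E) (t : B ~> T), t ∘ f = t ∘ g ->
    exists! h : Q ~> T, h ∘ q = t.

Definition regular_epi (A B : E) (r : A ~> B) : Prop :=
  exists (R : E) (f g : R ~> A), is_coequalizer f g r.

Definition jointly_monic (R A B : E) (r1 : R ~> A) (r2 : R ~> B) : Prop :=
  forall (T : E) (h k : T ~> R),
    r1 ∘ h = r1 ∘ k -> r2 ∘ h = r2 ∘ k -> h = k.

Definition equivalence_relation (R X : E) (r1 r2 : R ~> X) : Prop :=
  jointly_monic r1 r2 /\
  (exists rho : X ~> R, r1 ∘ rho = idm X /\ r2 ∘ rho = idm X) /\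
  (exists sigma : R ~> R, r1 ∘ sigma = r2 /\ r2 ∘ sigma = r1) /\
  (exists (W : E) (p1 p2 : W ~> R), is_pullback r2 r1 p1 p2 /\
     exists tau : W ~> R, r1 ∘ tau = r1 ∘ p1 /\ r2 ∘ tau = r2 ∘ p2).

Definition exact : Prop :=
  has_finite_limits /\
  (forall (A B D P : E) (f : A ~> D) (g : B ~> D)
          (p1 : P ~> A) (p2 : P ~> B),
     is_pullback f g p1 p2 -> regular_epi f -> regular_epi p2) /\
  (forall (R X : E) (r1 r2 : R ~> X), equivalence_relation r1 r2 ->
     exists (Q : E) (q : X ~> Q),
       is_coequalizer r1 r2 q /\ is_pullback q q r1 r2).

Definition projective (P : E) : Prop :=
  forall (A B : E) (r : A ~> B), regular_epi r ->
  forall f : P ~> B, exists f' : P ~> A, r ∘ f' = f.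

(* Products are only assumed to exist, not chosen: given product cones
   T <-t1- TP -t2-> P and C <-c1- CP -c2-> P, this says that m : TP ~> CP
   is the arrow t × id_P. *)
Definition is_times_id (P C CP T TP : E) (t1 : TP ~> T) (t2 : TP ~> P)
    (c1 : CP ~> C) (c2 : CP ~> P) (t : T ~> C) (m : TP ~> CP) : Prop :=
  c1 ∘ m = t ∘ t1 /\ c2 ∘ m = t2.

Definition internally_projective (P : E) : Prop :=
  forall (C CP : E) (c1 : CP ~> C) (c2 : CP ~> P), is_product c1 c2 ->
  forall (A B : E) (r : A ~> B), regular_epi r ->
  forall f : CP ~> B,
    exists (T : E) (t : T ~> C), regular_epi t /\
    exists (TP : E) (t1 : TP ~> T) (t2 : TP ~> P), is_product t1 t2 /\
    exists m : TP ~> CP, is_times_id t1 t2 c1 c2 t m /\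
    exists f' : TP ~> A, r ∘ f' = f ∘ m.

Definition is_exponential (A B X XA : E) (x1 : XA ~> X) (x2 : XA ~> A)
    (ev : XA ~> B) : Prop :=
  is_product x1 x2 /\
  forall (C CA : E) (c1 : CA ~> C) (c2 : CA ~> A), is_product c1 c2 ->
  forall f : CA ~> B,
    exists! g : C ~> X,
      exists m : CA ~> XA, is_times_id c1 c2 x1 x2 g m /\ ev ∘ m = f.

Definition cartesian_closed : Prop :=
  (exists U : E, is_terminal U) /\
  has_binary_products /\
  forall A B : E, exists (X XA : E) (x1 : XA ~> X) (x2 : XA ~> A)
    (ev : XA ~> B), is_exponential x1 x2 ev.

Definition projective_cover (P : E -> Prop) : Prop :=
  (forall X, P X -> projective X) /\
  (forall A : E, exists X, P X /\ exists q : X ~> A, regular_epi q).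

End Limits.

Section WeakLimits.

Variable C : Category.

Definition weak_product (Z X V : C) (p1 : V ~> Z) (p2 : V ~> X) : Prop :=
  forall (T : C) (f : T ~> Z) (g : T ~> X),
    exists h : T ~> V, p1 ∘ h = f /\ p2 ∘ h = g.

Definition weak_pullback (A B D P : C) (f : A ~> D) (g : B ~> D)
    (p1 : P ~> A) (p2 : P ~> B) : Prop :=
  f ∘ p1 = g ∘ p2 /\
  forall (T : C) (a : T ~> A) (b : T ~> B), f ∘ a = g ∘ b ->
    exists h : T ~> P, p1 ∘ h = a /\ p2 ∘ h = b.

Definition pseudo_equivalence_relation (X' X : C) (x1 x2 : X' ~> X) : Prop :=
  (exists rho : X ~> X', x1 ∘ rho = idm X /\ x2 ∘ rho = idm X) /\
  (exists sigma : X' ~> X', x1 ∘ sigma = x2 /\ x2 ∘ sigma = x1) /\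
  (exists (W : C) (p1 p2 : W ~> X'), weak_pullback x2 x1 p1 p2 /\
     exists tau : W ~> X', x1 ∘ tau = x1 ∘ p1 /\ x2 ∘ tau = x2 ∘ p2).

Definition weak_kernel_pair (Z X V V' : C) (p1 : V ~> Z) (p2 : V ~> X)
    (v1 v2 : V' ~> V) : Prop :=
  (p1 ∘ v1 = p1 ∘ v2 /\ p2 ∘ v1 = p2 ∘ v2) /\
  forall (T : C) (t1 t2 : T ~> V),
    p1 ∘ t1 = p1 ∘ t2 -> p2 ∘ t1 = p2 ∘ t2 ->
    exists h : T ~> V', v1 ∘ h = t1 /\ v2 ∘ h = t2.

Definition preserves_projections (Z X V Y' Y : C) (p1 : V ~> Z) (p2 : V ~> X)
    (y1 y2 : Y' ~> Y) (f : V ~> Y) : Prop :=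
  exists (V' : C) (v1 v2 : V' ~> V), weak_kernel_pair p1 p2 v1 v2 /\
  exists f' : V' ~> Y', y1 ∘ f' = f ∘ v1 /\ y2 ∘ f' = f ∘ v2.

Definition determined_by_projections (Z X V Y : C) (p1 : V ~> Z)
    (p2 : V ~> X) (f : V ~> Y) : Prop :=
  forall (T : C) (h k : T ~> V),
    p1 ∘ h = p1 ∘ k -> p2 ∘ h = p2 ∘ k -> f ∘ h = f ∘ k.

Record simple_product_data (Z X Y' Y : C) (y1 y2 : Y' ~> Y)
    (g1 : Y ~> Z) (g2 : Y ~> X) := {
  spW : C;
  spw : spW ~> Z;
  spV : C;
  spq1 : spV ~> spW;
  spq2 : spV ~> X;
  spe : spV ~> Y;
  sp_weak_product : weak_product spq1 spq2;
  sp_preserves : preserves_projections spq1 spq2 y1 y2 spe;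
  sp_comm1 : g1 ∘ spe = spw ∘ spq1;
  sp_comm2 : g2 ∘ spe = spq2
}.

Definition is_extensional_simple_product (Z X Y' Y : C) (y1 y2 : Y' ~> Y)
    (g1 : Y ~> Z) (g2 : Y ~> X) (D : simple_product_data y1 y2 g1 g2) : Prop :=
  forall D' : simple_product_data y1 y2 g1 g2,
    exists (h : spW D' ~> spW D) (k : spV D' ~> spV D),
      spw D ∘ h = spw D' /\
      spq1 D ∘ k = h ∘ spq1 D' /\
      spq2 D ∘ k = spq2 D' /\
      spe D ∘ k = spe D'.

Definition has_extensional_simple_products : Prop :=
  forall (Z X Y' Y : C) (y1 y2 : Y' ~> Y) (g1 : Y ~> Z) (g2 : Y ~> X),
    pseudo_equivalence_relation y1 y2 ->
    g1 ∘ y1 = g1 ∘ y2 -> g2 ∘ y1 = g2 ∘ y2 ->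
    exists D : simple_product_data y1 y2 g1 g2,
      is_extensional_simple_product D.

Definition is_weak_simple_product (Z X Y : C) (g1 : Y ~> Z) (g2 : Y ~> X)
    (D : simple_product_data (idm Y) (idm Y) g1 g2) : Prop :=
  is_extensional_simple_product D.

Definition has_weak_simple_products : Prop :=
  forall (Z X Y : C) (g1 : Y ~> Z) (g2 : Y ~> X),
    exists D : simple_product_data (idm Y) (idm Y) g1 g2,
      is_weak_simple_product D.

Definition weak_products_have_idempotents : Prop :=
  forall (Z X V : C) (p1 : V ~> Z) (p2 : V ~> X), weak_product p1 p2 ->
    exists i : V ~> V,
      i ∘ i = i /\ determined_by_projections p1 p2 i /\
      p1 ∘ i = p1 /\ p2 ∘ i = p2.

End WeakLimits.

(* Main.v *)
(* An arrow of E is a regular epi iff arrows from objects of P lift along it, and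
   an arrow can be defined on A by descent along a cover of A by an object of P;
   so E can be handled through its P-points.

   Each of (a), (b), (c) makes Z × X projective in E for Z, X in P.  A weak simple
   product of Y -> Z, Y -> X is the same as an arrow W × X -> Y over Z × X that is
   weakly universal among the arrows W' × X -> Y over Z × X with W' in P, and by
   projectivity of W' × X one may replace Y by any object of E.  For X in P this
   gives a weakly universal u : W × X -> B and, applied to equalisers, a relation
   on W whose P-points are the pairs (a, b) with u (a × id) = u (b × id); the
   quotient of W by it is B^X.  Exponents outside P are coequalisers of arrows of
   P.  Conversely, in a cartesian closed E, covering the actual simple product of
   the quotient of Y yields an extensional simple product. *)

From Stdlib Require Import FinFun IndefiniteDescription.
Require Import Defs.

Set Implicit Arguments.
Unset Strict Implicit.
Unset Printing Implicit Defensive.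

Local Open Scope cat_scope.

(** * Terminal objects, pullbacks and products from finite limits *)

Definition empty_category : Category.
Proof.
  refine {| Obj := Empty_set; Hom := fun _ _ => unit; idm := fun _ => tt;
    comp := fun _ _ _ _ _ => tt |}; intros [].
Defined.

Inductive cospan_obj := left_foot | right_foot | apex.

(** Every hom type computes to [unit] or [Empty_set], so the category laws and finiteness are
    settled by case analysis. *)
Definition cospan_hom (i j : cospan_obj) : Type :=
  match i, j with
  | left_foot, left_foot | right_foot, right_foot | _, apex => unit
  | _, _ => Empty_set
  end.

Definition cospan_id (i : cospan_obj) : cospan_hom i i :=
  match i with left_foot | right_foot | apex => tt end.

Definition cospan_comp (i j k : cospan_obj) (v : cospan_hom j k)
  (u : cospan_hom i j) : cospan_hom i k.
Proof.
  destruct i, j, k; first [exact tt | now destruct u | now destruct v].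
Defined.

Definition cospan : Category.
Proof.
  refine {| Obj := cospan_obj; Hom := cospan_hom; idm := cospan_id;
    comp := cospan_comp |}.
  - now intros [] [] [].
  - now intros [] [] [].
  - now intros [] [] [] [] [] [] [].
Defined.

Section FiniteLimits.

Variable E : Category.

Lemma Empty_set_finite : Finite Empty_set.
Proof. exists nil. intros []. Qed.

Lemma unit_finite : Finite unit.
Proof. exists (tt :: nil)%list. intros []; now left. Qed.

Definition cospan_functor (A B D : E) (f : A ~> D) (g : B ~> D) :
  Functor cospan E.
Proof.
  set (o := fun i : cospan =>
    match i with left_foot => A | right_foot => B | apex => D end : E).
  refine {| fobj := o; fmap := fun i j =>
    match i, j return cospan_hom i j -> (o i ~> o j) with
    | left_foot, left_foot => fun _ => idm A
    | right_foot, right_foot => fun _ => idm B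
    | apex, apex => fun _ => idm D
    | left_foot, apex => fun _ => f
    | right_foot, apex => fun _ => g
    | _, _ => fun u => match u with end
    end |}.
  - now intros [].
  - intros [] [] [] [] []; simpl; now rewrite ?comp_idl, ?comp_idr.
Defined.

Hypothesis E_lim : has_finite_limits E.

Lemma terminal_exists : exists U : E, is_terminal U.
Proof.
  assert (fin : finite_category empty_category).
  { split; [exact Empty_set_finite | intros []]. }
  unshelve epose (D := {| fobj := (fun i : empty_category => match i with end) : _ -> E |}).
  1-3: intros [].
  destruct (E_lim fin D) as (L & p & _ & univ).
  exists L. intros T.
  destruct (univ T (fun j => match j with end)) as (h & _ & uniq).
  { intros []. }
  exists h. split; [exact I |]. intros k _. apply uniq. intros [].
Qed.

Lemma pullback_exists (A B D : E) (f : A ~> D) (g : B ~> D) :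
  exists (L : E) (p1 : L ~> A) (p2 : L ~> B), is_pullback f g p1 p2.
Proof.
  assert (fin : finite_category cospan).
  { split.
    - exists (left_foot :: right_foot :: apex :: nil)%list.
      intros []; simpl; auto.
    - intros [] []; first [exact unit_finite | exact Empty_set_finite]. }
  destruct (E_lim fin (cospan_functor f g)) as (L & p & cone & univ).
  exists L, (p left_foot), (p right_foot). split.
  - transitivity (p apex).
    + exact (cone left_foot apex tt).
    + symmetry. exact (cone right_foot apex tt).
  - intros T a b ab.
    destruct (univ T (fun j => match j with
      | left_foot => a | right_foot => b | apex => f ∘ a end))
      as (h & hp & uniq).
    { intros [] [] []; simpl; auto using comp_idl. }
    exists h. split.
    + split; [exact (hp left_foot) | exact (hp right_foot)].
    + intros k [k1 k2]. apply uniq. intros []; try assumption.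
      transitivity (f ∘ p left_foot ∘ k).
      * f_equal. symmetry. exact (cone left_foot apex tt).
      * now rewrite <- comp_assoc, k1.
Qed.

Lemma binary_product_exists : has_binary_products E.
Proof.
  destruct terminal_exists as [U U_term].
  intros A B.
  destruct (U_term A) as (a & _), (U_term B) as (b & _).
  destruct (pullback_exists a b) as (L & p1 & p2 & _ & univ).
  exists L, p1, p2. intros T f g. apply univ.
  destruct (U_term T) as (t & _ & uniq).
  now rewrite <- (uniq (a ∘ f) I), <- (uniq (b ∘ g) I).
Qed.

End FiniteLimits.

(** * Chosen binary products and exponentials relative to them *)

(** Pairing becomes an operation subject to equations, and uniqueness becomes the extensionality
    rule [pair_ext], so diagrams over products can be rewritten. *)
Record products (E : Category) := {
  prod : E -> E -> E;
  pr1 : forall A B, prod A B ~> A;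
  pr2 : forall A B, prod A B ~> B;
  pair : forall T A B, (T ~> A) -> (T ~> B) -> (T ~> prod A B);
  pr1_pair : forall T A B (f : T ~> A) (g : T ~> B), pr1 A B ∘ pair f g = f;
  pr2_pair : forall T A B (f : T ~> A) (g : T ~> B), pr2 A B ∘ pair f g = g;
  pair_ext : forall T A B (h k : T ~> prod A B),
    pr1 A B ∘ h = pr1 A B ∘ k -> pr2 A B ∘ h = pr2 A B ∘ k -> h = k
}.

Arguments pr1 {E p A B}.
Arguments pr2 {E p A B}.
Arguments pair {E p T A B} f g.

(** Indefinite description selects cones and pairings; [inhabited] is enough, since the choice is
    only opened to prove propositions. *)
Lemma choose_products (E : Category) :
  has_binary_products E -> inhabited (products E).
Proof.
  intros H.
  assert (S : forall A B : E,
    {L : E & {p1 : L ~> A & {p2 : L ~> B | is_product p1 p2}}}).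
  { intros A B.
    destruct (constructive_indefinite_description _ (H A B)) as [L HL].
    destruct (constructive_indefinite_description _ HL) as [p1 H1].
    destruct (constructive_indefinite_description _ H1) as [p2 H2].
    now exists L, p1, p2. }
  assert (pairing : forall (T A B : E) (f : T ~> A) (g : T ~> B),
    {h | projT1 (projT2 (S A B)) ∘ h = f /\
         proj1_sig (projT2 (projT2 (S A B))) ∘ h = g}).
  { intros T A B f g. apply constructive_indefinite_description.
    destruct (proj2_sig (projT2 (projT2 (S A B))) T f g) as (h & hP & _).
    now exists h. }
  constructor.
  refine {| prod := fun A B => projT1 (S A B);
    pair := fun T A B f g => proj1_sig (pairing T A B f g) |}.
  - intros T A B f g. exact (proj1 (proj2_sig (pairing T A B f g))).
  - intros T A B f g. exact (proj2 (proj2_sig (pairing T A B f g))).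
  - intros T A B h k e1 e2.
    destruct (proj2_sig (projT2 (projT2 (S A B))) T _ _ :
      exists! l, _ = projT1 (projT2 (S A B)) ∘ k /\
        _ = proj1_sig (projT2 (projT2 (S A B))) ∘ k) as (l & _ & uniq).
    rewrite <- (uniq h), <- (uniq k); auto.
Qed.

Section ChosenProducts.

Variables (E : Category) (p : products E).

Local Notation "A × B" := (prod p A B) (at level 40, left associativity).
Local Notation π₁ := (pr1 (p := p)).
Local Notation π₂ := (pr2 (p := p)).
Local Notation "⟨ f , g ⟩" := (pair (p := p) f g) (at level 0, format "⟨ f ,  g ⟩").

Lemma pair_comp (S T A B : E) (f : T ~> A) (g : T ~> B) (h : S ~> T) :
  ⟨f, g⟩ ∘ h = ⟨f ∘ h, g ∘ h⟩.
Proof.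
  apply pair_ext; rewrite comp_assoc, ?pr1_pair, ?pr2_pair; reflexivity.
Qed.

Lemma pair_eta (T A B : E) (h : T ~> A × B) : ⟨π₁ ∘ h, π₂ ∘ h⟩ = h.
Proof. apply pair_ext; now rewrite ?pr1_pair, ?pr2_pair. Qed.

Lemma chosen_is_product (A B : E) :
  is_product (pr1 (p := p) (A := A) (B := B)) (pr2 (p := p)).
Proof.
  intros T f g. exists ⟨f, g⟩. split.
  - now rewrite pr1_pair, pr2_pair.
  - intros h [<- <-]. apply pair_eta.
Qed.

Definition times_id (A : E) (T C : E) (t : T ~> C) : T × A ~> C × A :=
  ⟨t ∘ π₁, π₂⟩.

Lemma times_id_pair (A S T C : E) (t : T ~> C) (f : S ~> T) (a : S ~> A) :
  times_id A t ∘ ⟨f, a⟩ = ⟨t ∘ f, a⟩.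
Proof.
  unfold times_id. now rewrite pair_comp, <- comp_assoc, pr1_pair, pr2_pair.
Qed.

Lemma times_id_comp (A S T C : E) (t : T ~> C) (s : S ~> T) :
  times_id A (t ∘ s) = times_id A t ∘ times_id A s.
Proof. unfold times_id at 1 3. now rewrite times_id_pair, comp_assoc. Qed.

Lemma pr1_times_id (A T C : E) (t : T ~> C) :
  π₁ ∘ times_id A t = t ∘ π₁.
Proof. apply pr1_pair. Qed.

Lemma pr2_times_id (A T C : E) (t : T ~> C) : π₂ ∘ times_id A t = π₂.
Proof. apply pr2_pair. Qed.

Definition chosen_exponential (A B X : E) (ev : X × A ~> B) : Prop :=
  forall (C : E) (f : C × A ~> B), exists! g : C ~> X, ev ∘ times_id A g = f.

(** An arbitrary product cone [CA] is compared with [C × A] by the isomorphism [i], along which [f]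
    is transported. *)
Lemma chosen_exponential_is_exponential (A B X : E) (ev : X × A ~> B) :
  chosen_exponential ev -> is_exponential π₁ π₂ ev.
Proof.
  intros H. split; [apply chosen_is_product |].
  intros C CA c1 c2 prod_c f.
  destruct (prod_c _ π₁ π₂) as (i & [i1 i2] & _).
  assert (iK : i ∘ ⟨c1, c2⟩ = idm CA).
  { destruct (prod_c _ c1 c2) as (j & _ & uniq).
    rewrite <- (uniq (i ∘ ⟨c1, c2⟩)), <- (uniq (idm CA)); [easy | |].
    - now rewrite !comp_idr.
    - rewrite !comp_assoc, i1, i2. now rewrite pr1_pair, pr2_pair. }
  assert (Ki : ⟨c1, c2⟩ ∘ i = idm (C × A)).
  { rewrite pair_comp, i1, i2.
    rewrite <- (pair_eta (idm _)), !comp_idr. reflexivity. }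
  destruct (H C (f ∘ i)) as (g & gP & uniq).
  exists g. split.
  - exists (times_id A g ∘ ⟨c1, c2⟩). split; [split |].
    + now rewrite comp_assoc, pr1_times_id, <- comp_assoc, pr1_pair.
    + now rewrite comp_assoc, pr2_times_id, pr2_pair.
    + now rewrite comp_assoc, gP, <- comp_assoc, iK, comp_idr.
  - intros g' (m & [m1 m2] & mP). apply uniq.
    rewrite <- mP, <- comp_assoc. f_equal.
    apply pair_ext.
    + rewrite pr1_times_id, comp_assoc, m1, <- comp_assoc. now rewrite i1.
    + rewrite pr2_times_id, comp_assoc, m2. now rewrite i2.
Qed.

Lemma is_exponential_chosen (A B X XA : E) (x1 : XA ~> X) (x2 : XA ~> A)
    (ev : XA ~> B) :
  is_exponential x1 x2 ev -> exists ev' : X × A ~> B, chosen_exponential ev'.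
Proof.
  intros [prod_x H].
  destruct (prod_x _ π₁ π₂) as (i & [i1 i2] & _).
  exists (ev ∘ i). intros C f.
  destruct (H C _ _ _ (chosen_is_product (A := C) (B := A)) f)
    as (g & (m & [m1 m2] & mP) & uniq).
  exists g. split.
  - rewrite <- mP, <- comp_assoc. f_equal.
    destruct (prod_x _ (x1 ∘ m) (x2 ∘ m)) as (j & _ & uniq_j).
    rewrite <- (uniq_j m), <- (uniq_j (i ∘ times_id A g)); auto.
    rewrite !comp_assoc, i1, i2, m1, m2. split; apply pr1_pair || apply pr2_pair.
  - intros g' g'P. apply uniq. exists (i ∘ times_id A g'). split; [split |].
    + now rewrite comp_assoc, i1, pr1_times_id.
    + now rewrite comp_assoc, i2, pr2_times_id.
    + now rewrite comp_assoc.
Qed.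

End ChosenProducts.

(** * Regular epis, descent and quotients tested on points from the projective cover *)

Lemma projective_retract (E : Category) (X Y : E) (s : Y ~> X) (r : X ~> Y) :
  r ∘ s = idm Y -> projective X -> projective Y.
Proof.
  intros rs X_proj A B e e_reg f.
  destruct (X_proj A B e e_reg (f ∘ r)) as [f' f'P].
  exists (f' ∘ s). now rewrite comp_assoc, f'P, <- comp_assoc, rs, comp_idr.
Qed.

Lemma regular_epi_epi (E : Category) (A B T : E) (r : A ~> B) (f g : B ~> T) :
  regular_epi r -> f ∘ r = g ∘ r -> f = g.
Proof.
  intros (R & a & b & ab & univ) fg.
  destruct (univ T (f ∘ r)) as (h & _ & uniq).
  { now rewrite <- !comp_assoc, ab. }
  now rewrite <- (uniq f), <- (uniq g).
Qed.

Section ProjectiveCover.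

Variables (E : Category) (P : E -> Prop).
Hypothesis E_exact : exact E.
Hypothesis P_cover : projective_cover P.
Variable p : products E.

Local Notation "A × B" := (prod p A B) (at level 40, left associativity).
Local Notation π₁ := (pr1 (p := p)).
Local Notation π₂ := (pr2 (p := p)).
Local Notation "⟨ f , g ⟩" := (pair (p := p) f g).
Local Notation "t ×id A" := (times_id p A t) (at level 35, A at next level).

Lemma cover_exists (A : E) : exists Q, P Q /\ exists c : Q ~> A, regular_epi c.
Proof. apply P_cover. Qed.

Lemma epi_of_lifting (A B T : E) (r : A ~> B) (f g : B ~> T) :
  (forall Q, P Q -> forall b : Q ~> B, exists a, r ∘ a = b) ->
  f ∘ r = g ∘ r -> f = g.
Proof.
  intros lift fg.
  destruct (cover_exists B) as (Q & PQ & c & c_reg).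
  destruct (lift Q PQ c) as [a <-].
  apply (regular_epi_epi c_reg). now rewrite !comp_assoc, fg.
Qed.

(** Compatibility is needed only on [P]-points: [r] coequalises some pair out of [R], and equality
    on [R] can be checked on a cover of [R]. *)
Lemma regular_epi_descent (A B T : E) (r : A ~> B) (t : A ~> T) :
  regular_epi r ->
  (forall Q, P Q -> forall a b : Q ~> A, r ∘ a = r ∘ b -> t ∘ a = t ∘ b) ->
  exists h : B ~> T, h ∘ r = t.
Proof.
  intros (R & f & g & fg & univ) H.
  destruct (cover_exists R) as (Q & PQ & c & c_reg).
  destruct (univ T t) as (h & hP & _).
  - apply (regular_epi_epi c_reg). rewrite <- !comp_assoc.
    apply (H Q PQ). now rewrite !comp_assoc, fg.
  - now exists h.
Qed.

(* The P-cover c of B lifts as c = r s; the map t s descends along c, and the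
   result agrees with t after pulling c back along r. *)
Lemma lifting_regular_epi (A B : E) (r : A ~> B) :
  (forall Q, P Q -> forall b : Q ~> B, exists a, r ∘ a = b) -> regular_epi r.
Proof.
  intros lift.
  destruct E_exact as (lim & stable & _).
  destruct (pullback_exists lim r r) as (R & k1 & k2 & kk & k_univ).
  exists R, k1, k2. split; [exact kk |].
  intros T t tk.
  assert (t_eq : forall (S : E) (a b : S ~> A), r ∘ a = r ∘ b -> t ∘ a = t ∘ b).
  { intros S a b ab. destruct (k_univ S a b ab) as (h & [<- <-] & _).
    now rewrite !comp_assoc, tk. }
  destruct (cover_exists B) as (Q & PQ & c & c_reg).
  destruct (lift Q PQ c) as [s rs].
  destruct (@regular_epi_descent _ _ _ c (t ∘ s) c_reg) as [h hc].
  { intros S _ a b ab. rewrite <- !comp_assoc. apply t_eq.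
    now rewrite !comp_assoc, rs. }
  assert (hr : h ∘ r = t).
  { destruct (pullback_exists lim c r) as (L & l1 & l2 & pb).
    pose proof (stable _ _ _ _ _ _ _ _ pb c_reg) as l2_reg.
    apply (regular_epi_epi l2_reg).
    rewrite <- comp_assoc, <- (proj1 pb), comp_assoc, hc, <- comp_assoc.
    apply t_eq. rewrite comp_assoc, rs. apply pb. }
  exists h. split; [exact hr |].
  intros h' h'r. apply (epi_of_lifting lift). now rewrite hr.
Qed.

Lemma regular_epi_lift (A B Q : E) (r : A ~> B) (b : Q ~> B) :
  regular_epi r -> P Q -> exists a, r ∘ a = b.
Proof.
  intros r_reg PQ. destruct P_cover as [proj _]. exact (proj Q PQ A B r r_reg b).
Qed.

Lemma regular_epi_times_id (A B X : E) (r : A ~> B) :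
  regular_epi r -> regular_epi (r ×id X).
Proof.
  intros r_reg. apply lifting_regular_epi. intros Q PQ b.
  destruct (regular_epi_lift (π₁ ∘ b) r_reg PQ) as [a ra].
  exists ⟨a, π₂ ∘ b⟩. now rewrite times_id_pair, ra, pair_eta.
Qed.

(** The equaliser is the pullback of [⟨f, g⟩] along the diagonal of [B]. *)
Lemma equalizer_exists (A B : E) (f g : A ~> B) :
  exists (L : E) (l : L ~> A), f ∘ l = g ∘ l /\
    (forall (T : E) (t : T ~> A), f ∘ t = g ∘ t -> exists h, l ∘ h = t) /\
    (forall (T : E) (h k : T ~> L), l ∘ h = l ∘ k -> h = k).
Proof.
  destruct (pullback_exists (proj1 E_exact) ⟨f, g⟩ ⟨idm B, idm B⟩)
    as (L & l & d & ld & univ).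
  rewrite !pair_comp, comp_idl in ld.
  assert (fl : f ∘ l = d) by (rewrite <- (pr1_pair p (f ∘ l) (g ∘ l)), ld; apply pr1_pair).
  assert (gl : g ∘ l = d) by (rewrite <- (pr2_pair p (f ∘ l) (g ∘ l)), ld; apply pr2_pair).
  exists L, l. split; [now rewrite fl, gl |]. split.
  - intros T t ft. destruct (univ T t (f ∘ t)) as (h & [hl _] & _).
    + rewrite !pair_comp, comp_idl. now rewrite <- ft.
    + now exists h.
  - intros T h k hk. destruct (univ T (l ∘ k) (d ∘ k)) as (m & _ & uniq).
    + now rewrite !comp_assoc, !pair_comp, comp_idl, fl, gl.
    + rewrite <- (uniq h), <- (uniq k); auto.
      split; [exact hk |]. rewrite <- fl, <- !comp_assoc. now f_equal.
Qed.

(* (s1, s2) need not be jointly monic: its image is the equivalence relation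
   whose coequaliser is taken, and an arrow factors through the image as soon
   as its P-points do. *)
Lemma quotient_exists (S W : E) (s1 s2 : S ~> W) :
  let rel Q (a b : Q ~> W) := exists l : Q ~> S, s1 ∘ l = a /\ s2 ∘ l = b in
  (forall Q, P Q -> forall a : Q ~> W, rel Q a a) ->
  (forall Q, P Q -> forall a b : Q ~> W, rel Q a b -> rel Q b a) ->
  (forall Q, P Q -> forall a b c : Q ~> W, rel Q a b -> rel Q b c -> rel Q a c) ->
  exists (B : E) (q : W ~> B), regular_epi q /\ q ∘ s1 = q ∘ s2 /\
    forall Q, P Q -> forall a b : Q ~> W, q ∘ a = q ∘ b -> rel Q a b.
Proof.
  intros rel rel_refl rel_sym rel_trans.
  destruct E_exact as (lim & stable & quot).
  (* The image [I] of [⟨s1, s2⟩] is obtained as the quotient of [S] by the kernel pair [K]. *)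
  destruct (pullback_exists lim ⟨s1, s2⟩ ⟨s1, s2⟩) as (K & k1 & k2 & pbK).
  destruct (quot K S k1 k2) as (I & c & coeq & _).
  { destruct pbK as [kk k_univ]. split; [| split; [| split]].
    - intros T h k e1 e2.
      destruct (k_univ T (k1 ∘ k) (k2 ∘ k)) as (m & _ & uniq).
      + now rewrite !comp_assoc, kk.
      + rewrite <- (uniq h), <- (uniq k); auto.
    - destruct (k_univ S (idm S) (idm S)) as (m & mP & _); [easy |].
      now exists m.
    - destruct (k_univ K k2 k1) as (m & mP & _); [easy |]. now exists m.
    - destruct (pullback_exists lim k2 k1) as (L & l1 & l2 & pbL).
      exists L, l1, l2. split; [exact pbL |].
      destruct (k_univ L (k1 ∘ l1) (k2 ∘ l2)) as (m & mP & _).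
      + rewrite !comp_assoc, kk, <- comp_assoc, (proj1 pbL), comp_assoc.
        now rewrite kk.
      + now exists m. }
  assert (c_reg : regular_epi c) by now exists K, k1, k2.
  destruct coeq as [ck c_univ].
  destruct (c_univ _ ⟨s1, s2⟩ (proj1 pbK)) as (m & mc & _).
  assert (r1c : π₁ ∘ m ∘ c = s1) by now rewrite <- comp_assoc, mc, pr1_pair.
  assert (r2c : π₂ ∘ m ∘ c = s2) by now rewrite <- comp_assoc, mc, pr2_pair.
  set (r1 := π₁ ∘ m) in *. set (r2 := π₂ ∘ m) in *.
  (* On [P]-points: points of [I] lift to [S] along [c], and lifts with equal images in [W × W] form
     a point of [K], which [c] collapses. *)
  assert (mono : jointly_monic r1 r2).
  { intros T h k e1 e2.
    destruct (cover_exists T) as (Q & PQ & t & t_reg).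
    apply (regular_epi_epi t_reg).
    destruct (regular_epi_lift (h ∘ t) c_reg PQ) as [a ca].
    destruct (regular_epi_lift (k ∘ t) c_reg PQ) as [b cb].
    destruct (proj2 pbK Q a b) as (l & [<- <-] & _).
    - rewrite !pair_comp, <- r1c, <- r2c, <- !comp_assoc, ca, cb, !comp_assoc.
      now rewrite e1, e2.
    - now rewrite <- ca, <- cb, !comp_assoc, ck. }
  (* The witness [l] over a cover of [T] is not unique, but [c ∘ l] is determined by its components
     by [mono], hence descends to [T]. *)
  assert (factor : forall (T : E) (a b : T ~> W),
    (forall Q, P Q -> forall t : Q ~> T, rel Q (a ∘ t) (b ∘ t)) ->
    exists h : T ~> I, r1 ∘ h = a /\ r2 ∘ h = b).
  { intros T a b H.
    destruct (cover_exists T) as (Q & PQ & t & t_reg).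
    destruct (H Q PQ t) as (l & l1 & l2).
    destruct (@regular_epi_descent _ _ _ t (c ∘ l) t_reg) as [h ht].
    - intros Q' _ u v uv. apply mono; rewrite !comp_assoc, ?r1c, ?r2c, ?l1, ?l2.
      + now rewrite <- !comp_assoc, uv.
      + now rewrite <- !comp_assoc, uv.
    - exists h. split; apply (regular_epi_epi t_reg);
        rewrite <- comp_assoc, ht, comp_assoc, ?r1c, ?r2c; assumption. }
  assert (rel_I : forall Q, P Q -> forall l : Q ~> I, rel Q (r1 ∘ l) (r2 ∘ l)).
  { intros Q PQ l. destruct (regular_epi_lift l c_reg PQ) as [a <-].
    exists a. now rewrite !comp_assoc, r1c, r2c. }
  destruct (quot I W r1 r2) as (B & q & q_coeq & q_pb).
  { split; [exact mono | split; [| split]].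
    - apply factor. intros Q PQ t. rewrite comp_idl. now apply rel_refl.
    - apply factor. intros Q PQ t. now apply rel_sym, rel_I.
    - destruct (pullback_exists lim r2 r1) as (L & l1 & l2 & pbL).
      exists L, l1, l2. split; [exact pbL |].
      apply factor. intros Q PQ t. apply rel_trans with (r2 ∘ l1 ∘ t); [easy | |].
      + rewrite <- !comp_assoc. now apply rel_I.
      + rewrite (proj1 pbL), <- !comp_assoc. now apply rel_I. }
  exists B, q. split; [now exists I, r1, r2 |]. split.
  - now rewrite <- r1c, <- r2c, !comp_assoc, (proj1 q_coeq).
  - intros Q PQ a b ab. destruct (proj2 q_pb Q a b ab) as (l & [<- <-] & _).
    now apply rel_I.
Qed.


(** * Weak products and preservation of projections, read in [E] *)

Local Notation "⌊ X ⌋" := (proj1_sig X) (at level 0, X at level 99).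

(** The weak universal property says that [P]-points of [Z × X] lift along [⟨p1, p2⟩], which
    characterises regular epis. *)
Lemma weak_product_iff_regular_epi (Z X V : FullSub P) (p1 : V ~> Z) (p2 : V ~> X) :
  weak_product p1 p2 <-> @regular_epi E _ _ ⟨p1, p2⟩.
Proof.
  split.
  - intros H. apply lifting_regular_epi. intros Q PQ b.
    destruct (H (exist P Q PQ) (π₁ ∘ b) (π₂ ∘ b)) as (a & a1 & a2).
    exists a. rewrite pair_comp, <- (pair_eta b). exact (f_equal2 _ a1 a2).
  - intros H [T PT] f g. simpl in f, g.
    destruct (regular_epi_lift ⟨f, g⟩ H PT) as [h hP].
    rewrite pair_comp in hP. exists h. simpl. split.
    + rewrite <- (pr1_pair p f g), <- hP. now rewrite pr1_pair.
    + rewrite <- (pr2_pair p f g), <- hP. now rewrite pr2_pair.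
Qed.

(** Two [P]-points of [V] with equal projections factor through the weak kernel pair, so [e] sends
    them to points that [q] identifies; thus [q ∘ e] descends to [Z × X]. *)
Lemma preserves_projections_factor (Z X V Y' Y : FullSub P)
    (p1 : V ~> Z) (p2 : V ~> X) (y1 y2 : Y' ~> Y) (e : V ~> Y)
    (B : E) (q : ⌊Y⌋ ~> B) :
  weak_product p1 p2 -> preserves_projections p1 p2 y1 y2 e ->
  comp (c := E) q y1 = comp (c := E) q y2 ->
  exists d : ⌊Z⌋ × ⌊X⌋ ~> B, d ∘ ⟨p1, p2⟩ = comp (c := E) q e.
Proof.
  intros wp (V' & v1 & v2 & [_ univ] & e' & e1 & e2) qy.
  apply regular_epi_descent; [now apply weak_product_iff_regular_epi |].
  intros Q PQ a b ab. rewrite !pair_comp in ab.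
  destruct (univ (exist P Q PQ) a b) as (l & l1 & l2).
  - apply (f_equal (comp π₁)) in ab. now rewrite !pr1_pair in ab.
  - apply (f_equal (comp π₂)) in ab. now rewrite !pr2_pair in ab.
  - simpl in *.
    now rewrite <- l1, <- l2, <- !(comp_assoc q), !(comp_assoc e), <- e1, <- e2,
      !comp_assoc, qy.
Qed.

(** Converse direction: a [P]-cover of the actual kernel pair of [v] is a weak kernel pair, and
    [lift] turns equality under [q] into the required arrow to [Y']. *)
Lemma factor_preserves_projections (Z X V Y' Y : FullSub P)
    (v : ⌊V⌋ ~> ⌊Z⌋ × ⌊X⌋) (y1 y2 : Y' ~> Y) (e : V ~> Y)
    (B : E) (q : ⌊Y⌋ ~> B) (d : ⌊Z⌋ × ⌊X⌋ ~> B) :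
  (forall Q, P Q -> forall a b : Q ~> ⌊Y⌋, q ∘ a = q ∘ b ->
    exists l : Q ~> ⌊Y'⌋, comp (c := E) y1 l = a /\ comp (c := E) y2 l = b) ->
  d ∘ v = comp (c := E) q e ->
  preserves_projections (C := FullSub P) (Z := Z) (X := X) (V := V)
    (π₁ ∘ v) (π₂ ∘ v) y1 y2 e.
Proof.
  intros lift dv.
  destruct (pullback_exists (proj1 E_exact) v v) as (K & k1 & k2 & kk & univ).
  destruct (cover_exists K) as (V' & PV' & c & c_reg).
  assert (vc : v ∘ (k1 ∘ c) = v ∘ (k2 ∘ c)) by now rewrite !comp_assoc, kk.
  exists (exist P V' PV'), (k1 ∘ c), (k2 ∘ c). split; [split; [split |] |]; simpl.
  - now rewrite <- !(comp_assoc π₁), vc.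
  - now rewrite <- !(comp_assoc π₂), vc.
  - intros [T PT] t1 t2 t1_eq t2_eq. simpl in *.
    destruct (univ T t1 t2) as (l & [<- <-] & _).
    { apply pair_ext; now rewrite !comp_assoc. }
    destruct (regular_epi_lift l c_reg PT) as [m <-].
    exists m. now rewrite !comp_assoc.
  - apply (lift V' PV'). now rewrite !(comp_assoc q), <- dv, <- !comp_assoc, vc.
Qed.

(** * From weak simple products to exponentials *)

Section WeakSimpleProducts.

Hypothesis prod_projective : forall Z X, P Z -> P X -> projective (Z × X).
Hypothesis wsp : has_weak_simple_products (FullSub P).

(** An arrow [e] determined by projections is the restriction of a unique [d] on the actual product
    [W × X], so the weak product apex can be eliminated. *)
Lemma weak_simple_product_of_span (Z X Y : E) (g1 : Y ~> Z) (g2 : Y ~> X) :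
  P Z -> P X -> P Y ->
  exists (W : E) (w : W ~> Z) (d : W × X ~> Y),
    P W /\ g1 ∘ d = w ∘ π₁ /\ g2 ∘ d = π₂ /\
    forall (W' : E) (w' : W' ~> Z) (d' : W' × X ~> Y),
      P W' -> g1 ∘ d' = w' ∘ π₁ -> g2 ∘ d' = π₂ ->
      exists h : W' ~> W, w ∘ h = w' /\ d ∘ h ×id X = d'.
Proof.
  intros PZ PX PY.
  destruct (@wsp (exist P Z PZ) (exist P X PX) (exist P Y PY) g1 g2)
    as [D D_univ].
  assert (v_reg := proj1 (weak_product_iff_regular_epi _ _) (sp_weak_product (s := D))).
  destruct (preserves_projections_factor (Y := exist P Y PY) (q := idm Y) (sp_weak_product (s := D))
    (sp_preserves D) eq_refl) as [d dv].
  rewrite comp_idl in dv.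
  assert (comm1 := sp_comm1 D). assert (comm2 := sp_comm2 D).
  exists ⌊spW D⌋, (spw D), d. simpl in *. split; [exact (proj2_sig (spW D)) |].
  split; [| split].
  - apply (regular_epi_epi v_reg).
    now rewrite <- !comp_assoc, dv, pr1_pair.
  - apply (regular_epi_epi v_reg).
    now rewrite <- !comp_assoc, dv, pr2_pair.
  - intros W' w' d' PW' e1 e2.
    (* A competitor [d'] becomes simple product data by restriction to a cover of [W' × X], which is
       a weak product in the subcategory. *)
    destruct (cover_exists (W' × X)) as (V' & PV' & c & c_reg).
    assert (wp : weak_product (C := FullSub P) (Z := exist P W' PW')
      (X := exist P X PX) (V := exist P V' PV') (π₁ ∘ c) (π₂ ∘ c)).
    { apply weak_product_iff_regular_epi. now rewrite pair_eta. }
    assert (pres : preserves_projections (C := FullSub P) (Z := exist P W' PW')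
      (X := exist P X PX) (V := exist P V' PV') (Y' := exist P Y PY)
      (Y := exist P Y PY) (π₁ ∘ c) (π₂ ∘ c) (idm Y) (idm Y) (d' ∘ c)).
    { apply factor_preserves_projections with (B := Y) (q := idm Y) (d := d').
      - intros Q PQ a b ab. rewrite !comp_idl in ab. subst b.
        exists a. simpl. now rewrite comp_idl.
      - now rewrite comp_idl. }
    unshelve epose (D' := @Build_simple_product_data (FullSub P)
      (exist P Z PZ) (exist P X PX) (exist P Y PY) (exist P Y PY) (idm Y) (idm Y)
      g1 g2 (exist P W' PW') w' (exist P V' PV') (π₁ ∘ c) (π₂ ∘ c) (d' ∘ c) wp pres _ _).
    { simpl. now rewrite !comp_assoc, e1. }
    { simpl. now rewrite !comp_assoc, e2. }
    destruct (D_univ D') as (h & k & wh & k1 & k2 & ek). simpl in *.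
    exists h. split; [exact wh |].
    apply (regular_epi_epi c_reg). rewrite <- ek, <- dv, <- !comp_assoc.
    f_equal. rewrite <- (pair_eta c), times_id_pair, pair_comp.
    now rewrite k1, k2.
Qed.

(** Cover [M] by [Y] in [P]; projectivity of [W' × X] lifts every competitor from [M] to [Y]. *)
Lemma weak_simple_product_over (Z X M : E) (m1 : M ~> Z) (m2 : M ~> X) :
  P Z -> P X ->
  exists (W : E) (w : W ~> Z) (d : W × X ~> M),
    P W /\ m1 ∘ d = w ∘ π₁ /\ m2 ∘ d = π₂ /\
    forall (W' : E) (w' : W' ~> Z) (d' : W' × X ~> M),
      P W' -> m1 ∘ d' = w' ∘ π₁ -> m2 ∘ d' = π₂ ->
      exists h : W' ~> W, w ∘ h = w' /\ d ∘ h ×id X = d'.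
Proof.
  intros PZ PX.
  destruct (cover_exists M) as (Y & PY & r & r_reg).
  destruct (weak_simple_product_of_span (m1 ∘ r) (m2 ∘ r) PZ PX PY)
    as (W & w & d & PW & d1 & d2 & univ).
  exists W, w, (r ∘ d). rewrite !comp_assoc. repeat (split; [assumption |]).
  intros W' w' d' PW' e1 e2.
  destruct (prod_projective PW' PX r_reg d') as [d'' <-].
  rewrite !comp_assoc in e1, e2.
  destruct (univ W' w' d'' PW' e1 e2) as (h & wh & dh).
  exists h. now rewrite <- comp_assoc, dh.
Qed.

Lemma weak_exponential_exists (X B : E) : P X ->
  exists (W : E) (u : W × X ~> B), P W /\
    forall (W' : E) (u' : W' × X ~> B), P W' ->
      exists h : W' ~> W, u ∘ h ×id X = u'.
Proof.
  intros PX.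
  destruct (terminal_exists (proj1 E_exact)) as [U U_term].
  (* The terminal object need not lie in [P]; a cover [Z] replaces it, since every object of [P] has
     some arrow to [Z]. Arrows to [Z × X × B] over [Z × X] then encode arrows to [B]. *)
  destruct (cover_exists U) as (Z & PZ & z & z_reg).
  destruct (weak_simple_product_over (M := Z × X × B) (π₁ ∘ π₁) (π₂ ∘ π₁) PZ PX)
    as (W & w & d & PW & _ & _ & univ).
  exists W, (π₂ ∘ d). split; [exact PW |].
  intros W' u' PW'.
  destruct (U_term W') as (t & _).
  destruct (regular_epi_lift t z_reg PW') as [w' _].
  destruct (univ W' w' ⟨w' ×id X, u'⟩ PW') as (h & _ & dh).
  - now rewrite <- comp_assoc, pr1_pair, pr1_times_id.
  - now rewrite <- comp_assoc, pr1_pair, pr2_times_id.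
  - exists h. now rewrite <- comp_assoc, dh, pr2_pair.
Qed.

Lemma equality_relation_exists (W X B : E) (u : W × X ~> B) : P X ->
  exists (S : E) (s1 s2 : S ~> W), forall Q, P Q -> forall a b : Q ~> W,
    (exists l : Q ~> S, s1 ∘ l = a /\ s2 ∘ l = b) <->
    u ∘ a ×id X = u ∘ b ×id X.
Proof.
  intros PX.
  (* [Z] parametrises pairs of points of [W], and [M] consists of those [(z, x)] at which the two
     functions named by [z] agree. A pair agreeing at all [x] thus gives an arrow to [M] over
     [Z × X]. *)
  destruct (cover_exists (W × W)) as (Z & PZ & z & z_reg).
  destruct (equalizer_exists (u ∘ (π₁ ∘ z) ×id X) (u ∘ (π₂ ∘ z) ×id X))
    as (M & m & m_eq & m_univ & _).
  destruct (weak_simple_product_over (π₁ ∘ m) (π₂ ∘ m) PZ PX)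
    as (S & s & d & PS & d1 & d2 & univ).
  assert (md : m ∘ d = s ×id X).
  { apply pair_ext.
    - now rewrite comp_assoc, pr1_times_id.
    - now rewrite comp_assoc, pr2_times_id. }
  exists S, (π₁ ∘ z ∘ s), (π₂ ∘ z ∘ s). intros Q PQ a b. split.
  - intros (l & <- & <-). rewrite !times_id_comp, !comp_assoc.
    f_equal. rewrite <- md, !comp_assoc. rewrite !times_id_comp, !comp_assoc in m_eq.
    now rewrite m_eq.
  - intros ab.
    destruct (regular_epi_lift ⟨a, b⟩ z_reg PQ) as [l zl].
    assert (l1 : π₁ ∘ z ∘ l = a) by now rewrite <- comp_assoc, zl, pr1_pair.
    assert (l2 : π₂ ∘ z ∘ l = b) by now rewrite <- comp_assoc, zl, pr2_pair.
    destruct (m_univ _ (l ×id X)) as [d' md'].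
    { rewrite <- !comp_assoc, <- !times_id_comp. now rewrite l1, l2. }
    destruct (univ Q l d' PQ) as (h & sh & _).
    + now rewrite <- comp_assoc, md', pr1_times_id.
    + now rewrite <- comp_assoc, md', pr2_times_id.
    + exists h. now rewrite <- !(comp_assoc _ s), sh.
Qed.

Lemma exponential_by_P_exists (X B : E) : P X ->
  exists (I : E) (ev : I × X ~> B), chosen_exponential ev.
Proof.
  intros PX.
  destruct (weak_exponential_exists B PX) as (W & u & PW & u_weak).
  destruct (equality_relation_exists u PX) as (S & s1 & s2 & S_rel).
  destruct (quotient_exists (S := S) (W := W) (s1 := s1) (s2 := s2))
    as (I & q & q_reg & qs & q_rel).
  { intros Q PQ a. now apply S_rel. }
  { intros Q PQ a b ab. apply S_rel; [exact PQ |].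
    symmetry. now apply S_rel. }
  { intros Q PQ a b c ab bc. apply S_rel; [exact PQ |].
    transitivity (u ∘ b ×id X); now apply S_rel. }
  assert (q_iff : forall Q, P Q -> forall a b : Q ~> W,
    q ∘ a = q ∘ b <-> u ∘ a ×id X = u ∘ b ×id X).
  { intros Q PQ a b. split.
    - intros ab. apply S_rel, q_rel; assumption.
    - intros ab. apply S_rel in ab as (l & <- & <-); [| exact PQ].
      now rewrite !comp_assoc, qs. }
  (* Evaluation on the quotient: [u] descends along [q ×id X] because [q]-equal points of [W] name
     the same function. *)
  destruct (regular_epi_descent (t := u) (regular_epi_times_id X q_reg))
    as [ev ev_q].
  { intros Q PQ x y xy.
    rewrite <- (pair_eta x), <- (pair_eta y) in *.
    rewrite !times_id_pair in xy.
    assert (xy2 : π₂ ∘ x = π₂ ∘ y).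
    { apply (f_equal (comp π₂)) in xy. now rewrite !pr2_pair in xy. }
    apply (f_equal (comp π₁)) in xy. rewrite !pr1_pair in xy.
    apply q_iff in xy; [| exact PQ].
    rewrite <- xy2.
    (* Each point [⟨w, y⟩] is written as [w ×id X] after [⟨id, y⟩], where [xy] applies. *)
    rewrite <- (comp_idr (π₁ ∘ x)), <- (comp_idr (π₁ ∘ y)), <- !times_id_pair.
    now rewrite !comp_assoc, xy. }
  assert (ev_point : forall Q (a : Q ~> W),
    ev ∘ (q ∘ a) ×id X = u ∘ a ×id X).
  { intros Q a. now rewrite times_id_comp, comp_assoc, ev_q. }
  exists I, ev. intros C f.
  destruct (cover_exists C) as (Q & PQ & c & c_reg).
  (* The weak transpose [h] exists over a cover of [C] and is unique up to [q], so [q ∘ h] descends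
     to the transpose of [f]. *)
  destruct (u_weak Q (f ∘ c ×id X) PQ) as [h uh].
  destruct (regular_epi_descent (r := c) (t := q ∘ h) c_reg) as [g gc].
  { intros Q' PQ' a b ab. rewrite <- !comp_assoc. apply q_iff; [exact PQ' |].
    now rewrite !times_id_comp, !comp_assoc, uh, <- !comp_assoc, <- !times_id_comp, ab. }
  exists g. split.
  - apply (regular_epi_epi (regular_epi_times_id X c_reg)).
    now rewrite <- comp_assoc, <- times_id_comp, gc, ev_point.
  - intros g' g'P. apply (regular_epi_epi c_reg). rewrite gc.
    destruct (regular_epi_lift (g' ∘ c) q_reg PQ) as [h' h'P].
    rewrite <- h'P. apply q_iff; [exact PQ |].
    rewrite uh, <- ev_point, h'P, times_id_comp, comp_assoc. now rewrite g'P.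
Qed.

(* A is the coequaliser of X1 => X with X, X1 in P, so B^A is the equaliser of
   B^X => B^X1. *)
Lemma exponential_exists (A B : E) :
  exists (I : E) (ev : I × A ~> B), chosen_exponential ev.
Proof.
  destruct (cover_exists A) as (X & PX & x & x_reg).
  destruct (pullback_exists (proj1 E_exact) x x) as (N & n1 & n2 & nn & n_univ).
  destruct (cover_exists N) as (X1 & PX1 & n & n_reg).
  set (a := n1 ∘ n). set (b := n2 ∘ n).
  assert (xab : x ∘ a = x ∘ b) by (unfold a, b; now rewrite !comp_assoc, nn).
  assert (ab_lift : forall Q, P Q -> forall y z : Q ~> X, x ∘ y = x ∘ z ->
    exists l, a ∘ l = y /\ b ∘ l = z).
  { intros Q PQ y z yz. destruct (n_univ Q y z yz) as (l & [<- <-] & _).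
    destruct (regular_epi_lift l n_reg PQ) as [m <-].
    exists m. unfold a, b. now rewrite !comp_assoc. }
  destruct (exponential_by_P_exists B PX) as (I & ev & ev_univ).
  destruct (exponential_by_P_exists B PX1) as (I1 & ev1 & ev1_univ).
  (* [α] and [β] are precomposition with [a] and [b], as arrows from [B^X] to [B^X1]. *)
  destruct (ev1_univ I (ev ∘ ⟨π₁, a ∘ π₂⟩)) as (α & αP & _).
  destruct (ev1_univ I (ev ∘ ⟨π₁, b ∘ π₂⟩)) as (β & βP & _).
  assert (α_pt : forall T (i : T ~> I) (y : T ~> X1),
    ev1 ∘ ⟨α ∘ i, y⟩ = ev ∘ ⟨i, a ∘ y⟩).
  { intros T i y. rewrite <- times_id_pair, comp_assoc, αP, <- comp_assoc.
    now rewrite pair_comp, <- comp_assoc, pr1_pair, pr2_pair. }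
  assert (β_pt : forall T (i : T ~> I) (y : T ~> X1),
    ev1 ∘ ⟨β ∘ i, y⟩ = ev ∘ ⟨i, b ∘ y⟩).
  { intros T i y. rewrite <- times_id_pair, comp_assoc, βP, <- comp_assoc.
    now rewrite pair_comp, <- comp_assoc, pr1_pair, pr2_pair. }
  destruct (equalizer_exists α β) as (L & l & l_eq & l_univ & l_mono).
  set (idx := fun T : E => ⟨π₁, x ∘ π₂⟩ : T × X ~> T × A).
  assert (idx_pair : forall T Q (t : Q ~> T) (y : Q ~> X),
    idx T ∘ ⟨t, y⟩ = ⟨t, x ∘ y⟩).
  { intros. unfold idx.
    now rewrite pair_comp, <- comp_assoc, pr1_pair, pr2_pair. }
  assert (idx_times_id : forall S T (t : S ~> T),
    t ×id A ∘ idx S = idx T ∘ t ×id X).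
  { intros. unfold idx at 1. unfold times_id at 2.
    now rewrite idx_pair, times_id_pair. }
  assert (idx_reg : forall T, regular_epi (idx T)).
  { intros T. apply lifting_regular_epi. intros Q PQ c.
    destruct (regular_epi_lift (π₂ ∘ c) x_reg PQ) as [y xy].
    exists ⟨π₁ ∘ c, y⟩. now rewrite idx_pair, xy, pair_eta. }
  (* On the equaliser [L], evaluation takes equal values at [a ∘ m] and [b ∘ m], and points of [X]
     identified by [x] have this form. *)
  destruct (regular_epi_descent (t := ev ∘ l ×id X) (idx_reg L)) as [evA evA_idx].
  { intros Q PQ y z yz.
    rewrite <- (pair_eta y), <- (pair_eta z) in *.
    rewrite !idx_pair in yz.
    assert (yz1 : π₁ ∘ y = π₁ ∘ z).
    { apply (f_equal (comp π₁)) in yz. now rewrite !pr1_pair in yz. }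
    apply (f_equal (comp π₂)) in yz. rewrite !pr2_pair in yz.
    destruct (ab_lift Q PQ _ _ yz) as (m & <- & <-). rewrite <- yz1.
    rewrite <- !comp_assoc, !times_id_pair, <- α_pt, <- β_pt, !comp_assoc.
    now rewrite l_eq. }
  assert (evA_pt : forall T (t : T ~> L),
    evA ∘ t ×id A ∘ idx T = ev ∘ (l ∘ t) ×id X).
  { intros T t. rewrite <- comp_assoc, idx_times_id, comp_assoc, evA_idx.
    now rewrite <- comp_assoc, <- times_id_comp. }
  exists L, evA. intros C f.
  destruct (ev_univ C (f ∘ idx C)) as (g & gP & g_uniq).
  assert (g_pt : forall T (t : T ~> C) (y : T ~> X),
    ev ∘ ⟨g ∘ t, y⟩ = f ∘ ⟨t, x ∘ y⟩).
  { intros T t y. now rewrite <- times_id_pair, comp_assoc, gP, <- comp_assoc, idx_pair. }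
  (* The transpose [g] of [f ∘ idx C] factors through [L]: both composites with [α] and [β]
     transpose the same arrow, as [x ∘ a = x ∘ b]. *)
  destruct (l_univ C g) as [h lh].
  { destruct (ev1_univ C (f ∘ ⟨π₁, x ∘ a ∘ π₂⟩)) as (k & _ & k_uniq).
    rewrite <- (k_uniq (α ∘ g)), <- (k_uniq (β ∘ g)); [reflexivity | |];
      unfold times_id; rewrite <- comp_assoc, ?α_pt, ?β_pt, g_pt, comp_assoc.
    - now rewrite xab.
    - reflexivity. }
  exists h. split.
  - apply (regular_epi_epi (idx_reg C)). now rewrite evA_pt, lh, gP.
  - intros h' h'P. apply l_mono. rewrite lh. apply g_uniq.
    now rewrite <- evA_pt, h'P.
Qed.

Lemma cartesian_closed_of_weak_simple_products : cartesian_closed E.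
Proof.
  split; [exact (terminal_exists (proj1 E_exact)) | split].
  - exact (binary_product_exists (proj1 E_exact)).
  - intros A B. destruct (exponential_exists A B) as (I & ev & ev_univ).
    exists I, (I × A), π₁, π₂, ev. now apply chosen_exponential_is_exponential.
Qed.

End WeakSimpleProducts.

(** * From cartesian closure to extensional simple products *)

Section CartesianClosed.

Hypothesis E_ccc : cartesian_closed E.

Lemma chosen_exponential_exists (A B : E) :
  exists (I : E) (ev : I × A ~> B), chosen_exponential ev.
Proof.
  destruct E_ccc as (_ & _ & H). destruct (H A B) as (I & IA & x1 & x2 & ev & evP).
  exists I. exact (is_exponential_chosen p evP).
Qed.

(* S is the pullback of B^X -> (Z × X)^X <- Z, the right map being the
   transpose of the identity. *)
Lemma simple_product_exists (Z X B : E) (b1 : B ~> Z) (b2 : B ~> X) :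
  exists (S : E) (s : S ~> Z) (d : S × X ~> B),
    b1 ∘ d = s ∘ π₁ /\ b2 ∘ d = π₂ /\
    forall (T : E) (t : T ~> Z) (d' : T × X ~> B),
      b1 ∘ d' = t ∘ π₁ -> b2 ∘ d' = π₂ ->
      exists h : T ~> S, s ∘ h = t /\ d ∘ h ×id X = d'.
Proof.
  destruct (chosen_exponential_exists X B) as (I & ev & ev_univ).
  destruct (chosen_exponential_exists X (Z × X)) as (K & evK & evK_univ).
  destruct (evK_univ I (⟨b1, b2⟩ ∘ ev)) as (φ & φP & _).
  destruct (evK_univ Z (idm _)) as (η & ηP & _).
  destruct (pullback_exists (proj1 E_exact) φ η) as (S & r & s & rs & univ).
  assert (bd : ⟨b1, b2⟩ ∘ (ev ∘ r ×id X) = s ×id X).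
  { rewrite comp_assoc, <- φP, <- comp_assoc, <- times_id_comp, rs, times_id_comp.
    now rewrite comp_assoc, ηP, comp_idl. }
  rewrite pair_comp in bd.
  exists S, s, (ev ∘ r ×id X). split; [| split].
  - apply (f_equal (comp π₁)) in bd. now rewrite pr1_pair, pr1_times_id in bd.
  - apply (f_equal (comp π₂)) in bd. now rewrite pr2_pair, pr2_times_id in bd.
  - intros T t d' e1 e2.
    destruct (ev_univ T d') as (g & gP & _).
    destruct (univ T g t) as (h & [rh sh] & _).
    (* Both [φ ∘ g] and [η ∘ t] are transposes of [t ×id X]; for the former this says that [d'] lies
       over [Z × X]. *)
    + destruct (evK_univ T (t ×id X)) as (k & _ & k_uniq).
      rewrite <- (k_uniq (φ ∘ g)), <- (k_uniq (η ∘ t)); [reflexivity | |];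
        rewrite times_id_comp, comp_assoc, ?φP, ?ηP.
      * apply comp_idl.
      * rewrite <- comp_assoc, gP, pair_comp, e1, e2. reflexivity.
    + exists h. split; [exact sh |].
      now rewrite <- comp_assoc, <- times_id_comp, rh.
Qed.

(* With B the quotient of Y by y1, y2, data D amount to a simple product datum
   W × X -> B of B; covering (W × X) ×_B Y makes e o k = e' hold strictly. *)
Lemma extensional_simple_products_of_cartesian_closed :
  has_extensional_simple_products (FullSub P).
Proof.
  intros [Z PZ] [X PX] [Y' PY'] [Y PY] y1 y2 g1 g2 pseudo g1y g2y.
  destruct pseudo as ((ρ & ρ1 & ρ2) & (σ & σ1 & σ2) & (N & n1 & n2 & n_wp & τ & τ1 & τ2)).
  simpl in *.
  destruct (quotient_exists (S := Y') (W := Y) (s1 := y1) (s2 := y2))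
    as (B & q & q_reg & qy & q_rel).
  { intros Q PQ a. exists (ρ ∘ a). now rewrite !comp_assoc, ρ1, ρ2, comp_idl. }
  { intros Q PQ a b (l & <- & <-). exists (σ ∘ l).
    now rewrite !comp_assoc, σ1, σ2. }
  { intros Q PQ a b c (l & <- & lb) (m & mb & <-).
    destruct (proj2 n_wp (exist P Q PQ) l m) as (k & k1 & k2).
    - simpl. now rewrite lb, mb.
    - simpl in *. exists (τ ∘ k).
      now rewrite !comp_assoc, τ1, τ2, <- !comp_assoc, k1, k2. }
  destruct (regular_epi_descent (t := g1) q_reg) as [b1 b1q].
  { intros Q PQ a b ab. destruct (q_rel Q PQ a b ab) as (l & <- & <-).
    now rewrite !comp_assoc, g1y. }
  destruct (regular_epi_descent (t := g2) q_reg) as [b2 b2q].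
  { intros Q PQ a b ab. destruct (q_rel Q PQ a b ab) as (l & <- & <-).
    now rewrite !comp_assoc, g2y. }
  destruct (simple_product_exists b1 b2) as (S & s & d & d1 & d2 & S_univ).
  destruct (cover_exists S) as (W & PW & c & c_reg).
  set (dW := d ∘ c ×id X).
  destruct (pullback_exists (proj1 E_exact) dW q) as (L & l1 & l2 & dl & L_univ).
  destruct (cover_exists L) as (V & PV & v & v_reg).
  assert (wp : weak_product (C := FullSub P) (Z := exist P W PW)
    (X := exist P X PX) (V := exist P V PV) (π₁ ∘ (l1 ∘ v)) (π₂ ∘ (l1 ∘ v))).
  { apply weak_product_iff_regular_epi. rewrite pair_eta.
    apply lifting_regular_epi. simpl. intros Q PQ a.
    destruct (regular_epi_lift (dW ∘ a) q_reg PQ) as [y qya].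
    destruct (L_univ Q a y (eq_sym qya)) as (k & [<- _] & _).
    destruct (regular_epi_lift k v_reg PQ) as [m <-].
    exists m. now rewrite !comp_assoc. }
  assert (pres : preserves_projections (C := FullSub P) (Z := exist P W PW)
    (X := exist P X PX) (V := exist P V PV) (Y' := exist P Y' PY')
    (Y := exist P Y PY) (π₁ ∘ (l1 ∘ v)) (π₂ ∘ (l1 ∘ v)) y1 y2 (l2 ∘ v)).
  { apply factor_preserves_projections with (B := B) (q := q) (d := dW).
    - exact q_rel.
    - simpl. now rewrite !comp_assoc, dl. }
  unshelve epose (D := @Build_simple_product_data (FullSub P)
    (exist P Z PZ) (exist P X PX) (exist P Y' PY') (exist P Y PY) y1 y2 g1 g2
    (exist P W PW) (s ∘ c) (exist P V PV) (π₁ ∘ (l1 ∘ v)) (π₂ ∘ (l1 ∘ v))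
    (l2 ∘ v) wp pres _ _).
  { simpl. rewrite <- b1q, !comp_assoc, <- (comp_assoc b1), <- dl. unfold dW.
    rewrite !comp_assoc, d1, <- (comp_assoc s), pr1_times_id, !comp_assoc.
    reflexivity. }
  { simpl. rewrite <- b2q, !comp_assoc, <- (comp_assoc b2), <- dl. unfold dW.
    now rewrite !comp_assoc, d2, pr2_times_id. }
  exists D. intros D'.
  assert (v'_reg := proj1 (weak_product_iff_regular_epi _ _)
    (sp_weak_product (s := D'))).
  destruct (preserves_projections_factor (Y := exist P Y PY) (q := q)
    (sp_weak_product (s := D')) (sp_preserves D') qy) as [d' d'P].
  assert (comm1 := sp_comm1 D'). assert (comm2 := sp_comm2 D').
  destruct D' as [[W' PW'] w' [V' PV'] q1' q2' e' wp' pres' comm1' comm2'].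
  simpl in *.
  (* [d'] is [q ∘ e'] descended to [W' × X]; its classifying arrow [t] to [S] lifts to the cover [W]
     because [W'] is in [P]. *)
  destruct (S_univ W' w' d') as (t & st & dt).
  { apply (regular_epi_epi v'_reg).
    now rewrite <- !comp_assoc, d'P, pr1_pair, comp_assoc, b1q. }
  { apply (regular_epi_epi v'_reg).
    now rewrite <- !comp_assoc, d'P, pr2_pair, comp_assoc, b2q. }
  destruct (regular_epi_lift t c_reg PW') as [h ch].
  destruct (L_univ V' (h ×id X ∘ ⟨q1', q2'⟩) e') as (k & [k1 k2] & _).
  { unfold dW. rewrite comp_assoc, <- (comp_assoc d), <- times_id_comp, ch, dt.
    exact d'P. }
  destruct (regular_epi_lift k v_reg PV') as [m vm].
  exists h, m. rewrite times_id_pair in k1. repeat split.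
  - now rewrite <- comp_assoc, ch.
  - now rewrite <- !comp_assoc, vm, k1, pr1_pair.
  - now rewrite <- !comp_assoc, vm, k1, pr2_pair.
  - now rewrite <- comp_assoc, vm.
Qed.

End CartesianClosed.

(** * Projectivity of binary products from each of the three conditions *)

(** The cover [t] of [Z] given by internal projectivity splits, and its section induces a section
    [n] of [m], so the lift of [f ∘ m] restricts to a lift of [f]. *)
Lemma product_projective_of_internally_projective (Z X : E) :
  projective Z -> internally_projective X -> projective (Z × X).
Proof.
  intros Z_proj X_int A B r r_reg f.
  destruct (X_int _ _ _ _ (@chosen_is_product _ p Z X) A B r r_reg f)
    as (T & t & t_reg & TX & t1 & t2 & TX_prod & m & [m1 m2] & f' & f'P).
  destruct (Z_proj _ _ t t_reg (idm Z)) as [s ts].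
  destruct (TX_prod _ (s ∘ π₁) π₂) as (n & [n1 n2] & _).
  assert (mn : m ∘ n = idm _).
  { apply pair_ext; rewrite comp_idr, comp_assoc, ?m1, ?m2; [| exact n2].
    now rewrite <- comp_assoc, n1, comp_assoc, ts, comp_idl. }
  exists (f' ∘ n). now rewrite comp_assoc, f'P, <- comp_assoc, mn, comp_idr.
Qed.

(* The comparison from the product in the subcategory is a regular epi that is
   injective on P-points, hence a split one. *)
Lemma product_projective_of_binary_products (Z X : E) :
  has_binary_products (FullSub (@projective E)) ->
  projective Z -> projective X -> projective (Z × X).
Proof.
  intros H Z_proj X_proj.
  destruct (H (exist _ Z Z_proj) (exist _ X X_proj)) as ([V V_proj] & p1 & p2 & V_prod).
  simpl in p1, p2.
  assert (P_proj : forall Q, P Q -> projective Q) by apply P_cover.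
  assert (reg : regular_epi ⟨p1, p2⟩).
  { apply lifting_regular_epi. intros Q PQ b.
    destruct (V_prod (exist _ Q (P_proj Q PQ)) (π₁ ∘ b) (π₂ ∘ b))
      as (h & [h1 h2] & _).
    exists h. rewrite pair_comp, <- (pair_eta b). exact (f_equal2 _ h1 h2). }
  destruct (regular_epi_descent (t := idm V) reg) as [s sp].
  { intros Q PQ a b ab. rewrite !pair_comp in ab.
    destruct (V_prod (exist _ Q (P_proj Q PQ)) (p1 ∘ b) (p2 ∘ b))
      as (h & _ & uniq).
    rewrite !comp_idl, <- (uniq a), <- (uniq b); auto. split.
    - apply (f_equal (comp π₁)) in ab. now rewrite !pr1_pair in ab.
    - apply (f_equal (comp π₂)) in ab. now rewrite !pr2_pair in ab. }
  apply (projective_retract (s := s) (r := ⟨p1, p2⟩)); [| exact V_proj].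
  apply (regular_epi_epi reg). now rewrite <- comp_assoc, sp, comp_idl, comp_idr.
Qed.

(** Being determined by projections, [i] descends along the cover [v] to [s]; as [i] preserves both
    projections, [s] is a section of [v], making [Z × X] a retract of [V]. *)
Lemma product_projective_of_idempotents (Z X : E) :
  weak_products_have_idempotents (FullSub P) -> P Z -> P X -> projective (Z × X).
Proof.
  intros H PZ PX.
  destruct (cover_exists (Z × X)) as (V & PV & v & v_reg).
  destruct (H (exist P Z PZ) (exist P X PX) (exist P V PV) (π₁ ∘ v) (π₂ ∘ v))
    as (i & _ & i_det & i1 & i2).
  { apply weak_product_iff_regular_epi. now rewrite pair_eta. }
  simpl in *.
  destruct (regular_epi_descent (t := i) v_reg) as [s sv].
  { intros Q PQ a b ab. apply (i_det (exist P Q PQ)); simpl;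
      now rewrite <- !comp_assoc, ab. }
  apply (projective_retract (s := s) (r := v)).
  - apply (regular_epi_epi v_reg). rewrite <- comp_assoc, sv, comp_idl.
    apply pair_ext; now rewrite comp_assoc.
  - now apply P_cover.
Qed.

Lemma product_projective (Z X : E) :
  (forall X : E, projective X -> internally_projective X) \/
  has_binary_products (FullSub (@projective E)) \/
  weak_products_have_idempotents (FullSub P) ->
  P Z -> P X -> projective (Z × X).
Proof.
  assert (P_proj : forall Q, P Q -> projective Q) by apply P_cover.
  intros [a | [b | c]] PZ PX.
  - apply product_projective_of_internally_projective; auto.
  - apply product_projective_of_binary_products; auto.
  - now apply product_projective_of_idempotents.
Qed.

End ProjectiveCover.

(** * Identity pairs as pseudo equivalence relations, and the cycle of implications *)

Lemma extensional_weak_simple_products (C : Category) :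
  has_extensional_simple_products C -> has_weak_simple_products C.
Proof.
  intros H Z X Y g1 g2. apply H; try reflexivity.
  split; [| split].
  - exists (idm Y). now rewrite comp_idl.
  - exists (idm Y). now rewrite comp_idl.
  - exists Y, (idm Y), (idm Y). split.
    + split; [reflexivity |]. intros T a b ab. rewrite !comp_idl in ab.
      exists a. now rewrite !comp_idl.
    + now exists (idm Y).
Qed.

Theorem corollary4p14
  (E : Category) (E_exact : exact E)
  (P : E -> Prop) (P_cover : projective_cover P)
  (abc :
    (forall X : E, projective X -> internally_projective X) \/
    has_binary_products (FullSub (@projective E)) \/
    weak_products_have_idempotents (FullSub P)) :
  (has_weak_simple_products (FullSub P) <->
     has_extensional_simple_products (FullSub P)) /\
  (has_extensional_simple_products (FullSub P) <-> cartesian_closed E).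
Proof.
  destruct (choose_products (binary_product_exists (proj1 E_exact))) as [p].
  assert (wsp_ccc : has_weak_simple_products (FullSub P) -> cartesian_closed E).
  { apply (cartesian_closed_of_weak_simple_products E_exact P_cover (p := p)).
    intros Z X. now apply product_projective. }
  assert (ccc_esp := extensional_simple_products_of_cartesian_closed E_exact P_cover p).
  assert (esp_wsp := @extensional_weak_simple_products (FullSub P)).
  tauto.
Qed.
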